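(* Let $(l_\prec,r_\prec,l_\succ,r_\succ,l_\ast,r_\ast,\beta_1,\beta_2,V)$ be a bimodule of a noncommutative BiHom-pre-Poisson algebra $(A,\prec,\succ,\ast,\alpha_1,\alpha_2)$. Then $A\oplus V$ is a noncommutative BiHom-pre-Poisson algebra with operations and structure maps given, for $x,y\in A$, $u,v\in V$, by $$(x+u)\prec'(y+v):=x\prec y+l_\prec(x)v+r_\prec(y)u,$$ $$(x+u)\succ'(y+v):=x\succ y+l_\succ(x)v+r_\succ(y)u,$$ $$(x+u)\ast'(y+v):=x\ast y+l_\ast(x)v+r_\ast(y)u,$$ $$(\alpha_1\oplus\beta_1)(x+u):=\alpha_1(x)+\beta_1(u),\qquad(\alpha_2\oplus\beta_2)(x+u):=\alpha_2(x)+\beta_2(u).$$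
   Context: All vector spaces are over a field $\mathbb{K}$ of characteristic different from $2$; $gl(V)$ denotes the space of linear endomorphisms of $V$. BiHom-dendriform algebra $(A,\prec,\succ,\alpha_1,\alpha_2)$: $\prec,\succ$ bilinear, $\alpha_1,\alpha_2$ commuting linear maps multiplicative for $\prec$ and $\succ$, and, with $x\cdot y=x\prec y+x\succ y$: $(x\prec y)\prec\alpha_2(z)=\alpha_1(x)\prec(y\cdot z)$; $(x\succ y)\prec\alpha_2(z)=\alpha_1(x)\succ(y\prec z)$; $\alpha_1(x)\succ(y\succ z)=(x\cdot y)\succ\alpha_2(z)$. BiHom-pre-Lie algebra $(A,\ast,\alpha_1,\alpha_2)$: $\ast$ bilinear, $\alpha_1,\alpha_2$ commuting linear maps multiplicative for $\ast$, and $(\alpha_2(x)\ast\alpha_1(y))\ast\alpha_2(z)-\alpha_1\alpha_2(x)\ast(\alpha_1(y)\ast z)=(\alpha_2(y)\ast\alpha_1(x))\ast\alpha_2(z)-\alpha_1\alpha_2(y)\ast(\alpha_1(x)\ast z)$. Noncommutative BiHom-pre-Poisson algebra $(A,\prec,\succ,\ast,\alpha_1,\alpha_2)$: $(A,\prec,\succ,\alpha_1,\alpha_2)$ is BiHom-dendriform, $(A,\ast,\alpha_1,\alpha_2)$ is BiHom-pre-Lie, and for all $x,y,z$: (P1) $(\alpha_2(x)\ast\alpha_1(y)-\alpha_2(y)\ast\alpha_1(x))\prec\alpha_2(z)=\alpha_1\alpha_2(x)\ast(\alpha_1(y)\prec z)-\alpha_1\alpha_2(y)\prec(\alpha_1(x)\ast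 z)$; (P2) $\alpha_2(x)\succ(\alpha_1\alpha_2(y)\ast\alpha_1(z)-\alpha_2(z)\ast\alpha_1^2(y))=\alpha_1\alpha_2^2(y)\ast(x\succ\alpha_1(z))-(\alpha_2^2(y)\ast x)\succ\alpha_1\alpha_2(z)$; (P3) $(\alpha_2(x)\prec\alpha_1(y)+\alpha_2(x)\succ\alpha_1(y))\ast\alpha_2(z)=(\alpha_2(x)\ast\alpha_1(z))\succ\alpha_2(y)+\alpha_1\alpha_2(x)\prec(\alpha_1(y)\ast z)$. A bimodule of it is $(l_\prec,r_\prec,l_\succ,r_\succ,l_\ast,r_\ast,\beta_1,\beta_2,V)$ with $V$ a vector space, $\beta_1,\beta_2:V\to V$ commuting linear maps, and six linear maps $l_\prec,r_\prec,l_\succ,r_\succ,l_\ast,r_\ast:A\to gl(V)$, each map $f$ among them satisfying $\beta_i(f(x)v)=f(\alpha_i(x))\beta_i(v)$ ($i=1,2$), such that, with $l_\cdot=l_\prec+l_\succ$ and $r_\cdot=r_\prec+r_\succ$, for all $x,y\in A$, $v\in V$: (Dendriform bimodule) $l_\prec(x\prec y)\beta_2(v)=l_\prec(\alpha_1(x))l_\cdot(y)v$; $r_\prec(\alpha_2(x))l_\prec(y)v=l_\prec(\alpha_1(y))r_\cdot(x)v$; $r_\prec(\alpha_2(y))r_\prec(x)v=r_\prec(x\cdot y)\beta_1(v)$; $l_\prec(x\succ y)\beta_2(v)=l_\succ(\alpha_1(x))l_\prec(y)v$; $r_\prec(\alpha_2(x))l_\succ(y)v=l_\succ(\alpha_1(y))r_\prec(x)v$;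 $r_\prec(\alpha_2(x))r_\succ(y)v=r_\succ(y\prec x)\beta_1(v)$; $l_\succ(x\cdot y)\beta_2(v)=l_\succ(\alpha_1(x))l_\succ(y)v$; $r_\succ(\alpha_2(x))l_\cdot(y)v=l_\succ(\alpha_1(y))r_\succ(x)v$; $r_\succ(\alpha_2(x))r_\cdot(y)v=r_\succ(y\succ x)\beta_1(v)$. (Pre-Lie bimodule) $l_\ast(\alpha_2(x)\ast\alpha_1(y)-\alpha_2(y)\ast\alpha_1(x))\beta_2(v)=l_\ast(\alpha_1\alpha_2(x))l_\ast(\alpha_1(y))v-l_\ast(\alpha_1\alpha_2(y))l_\ast(\alpha_1(x))v$; $r_\ast(\alpha_2(y))\big(l_\ast(\alpha_2(x))\beta_1(v)-r_\ast(\alpha_1(x))\beta_2(v)\big)=l_\ast(\alpha_1\alpha_2(x))r_\ast(y)\beta_1(v)-r_\ast(\alpha_1(x)\ast y)\beta_1\beta_2(v)$. (Compatibility) (B1) $l_\prec(\alpha_2(x)\ast\alpha_1(y)-\alpha_2(y)\ast\alpha_1(x))\beta_2(v)=l_\ast(\alpha_1\alpha_2(x))l_\prec(\alpha_1(y))v-l_\prec(\alpha_1\alpha_2(y))l_\ast(\alpha_1(x))v$; (B2) $r_\prec(\alpha_2(x))\big(l_\ast(\alpha_2(y))\beta_1(v)-r_\ast(\alpha_1(y))\beta_2(v)\big)=l_\ast(\alpha_1\alpha_2(y))r_\prec(x)\beta_1(v)-r_\prec(\alpha_1(y)\ast x)\beta_1\beta_2(v)$; (B3) $-r_\prec(\alpha_2(x))\big(l_\ast(\alpha_2(y))\beta_1(v)-r_\ast(\alpha_1(y))\beta_2(v)\big)=r_\ast(\alpha_1(y)\prec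 x)\beta_1\beta_2(v)-l_\prec(\alpha_1\alpha_2(y))r_\ast(x)\beta_1(v)$; (B4) $l_\succ(\alpha_2(x))\big(l_\ast(\alpha_1\alpha_2(y))\beta_1(v)-r_\ast(\alpha_1^2(y))\beta_2(v)\big)=l_\ast(\alpha_1\alpha_2^2(y))l_\succ(x)\beta_1(v)-l_\succ(\alpha_2^2(y)\ast x)\beta_1\beta_2(v)$; (B5) $r_\succ(\alpha_1\alpha_2(x)\ast\alpha_1(y)-\alpha_2(y)\ast\alpha_1^2(x))\beta_2(v)=l_\ast(\alpha_1\alpha_2^2(x))r_\succ(\alpha_1(y))v-r_\succ(\alpha_1\alpha_2(y))l_\ast(\alpha_2^2(x))v$; (B6) $-l_\succ(\alpha_2(x))\big(l_\ast(\alpha_2(y))\beta_1^2(v)-r_\ast(\alpha_1(y))\beta_1\beta_2(v)\big)=r_\ast(x\succ\alpha_1(y))\beta_1\beta_2^2(v)-r_\succ(\alpha_1\alpha_2(y))r_\ast(x)\beta_2^2(v)$; (B7) $l_\ast(\alpha_2(x)\cdot\alpha_1(y))\beta_2(v)=r_\succ(\alpha_2(y))l_\ast(\alpha_2(x))\beta_1(v)+l_\prec(\alpha_1\alpha_2(x))l_\ast(\alpha_1(y))v$; (B8) $r_\ast(\alpha_2(x))l_\cdot(\alpha_2(y))\beta_1(v)=l_\succ(\alpha_2(y)\ast\alpha_1(x))\beta_2(v)+l_\prec(\alpha_1\alpha_2(y))r_\ast(x)\beta_1(v)$; (B9) $r_\ast(\alpha_2(x))r_\cdot(\alpha_1(y))\beta_2(v)=r_\succ(\alpha_2(y))r_\ast(\alpha_1(x))\beta_2(v)+r_\prec(\alpha_1(y)\ast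 x)\beta_1\beta_2(v)$. *)

(* Defs.v *)
From HB Require Import structures.
From mathcomp Require Import all_boot all_order all_algebra.

Set Implicit Arguments.
Unset Strict Implicit.
Unset Printing Implicit Defensive.

Import GRing.Theory.
Local Open Scope ring_scope.

(* Vector spaces are [lmodType]s over a field, of arbitrary dimension.  All   *)
(* structures are predicates on plain functions, so linearity of the          *)
(* operations and of the structure maps is part of each of them.              *)

Section Algebras.

Variables (K : fieldType) (A : lmodType K).

Record bihom_maps (a1 a2 : A -> A) : Prop := BihomMaps {
  bm_linear1 : linear a1;
  bm_linear2 : linear a2;
  bm_commute : forall x, a1 (a2 x) = a2 (a1 x)
}.

Record bihom_operation (op : A -> A -> A) (a1 a2 : A -> A) : Prop :=
  BihomOperation {
    bo_bilinear : bilinear_for *:%R *:%R op;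
    bo_morph1 : {morph a1 : x y / op x y};
    bo_morph2 : {morph a2 : x y / op x y}
}.

Definition add_op (op1 op2 : A -> A -> A) (x y : A) : A := op1 x y + op2 x y.

Variables (prec succ ast : A -> A -> A) (a1 a2 : A -> A).

Local Notation "x ≺ y" := (prec x y) (at level 40, left associativity).
Local Notation "x ≻ y" := (succ x y) (at level 40, left associativity).
Local Notation "x ∗ y" := (ast x y) (at level 40, left associativity).
Local Notation "x ⋅ y" :=
  (add_op prec succ x y) (at level 40, left associativity).

Record bihom_dendriform : Prop := BihomDendriform {
  bd_maps : bihom_maps a1 a2;
  bd_prec : bihom_operation prec a1 a2;
  bd_succ : bihom_operation succ a1 a2;
  bd_prec_prec : forall x y z, (x ≺ y) ≺ a2 z = a1 x ≺ (y ⋅ z);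
  bd_succ_prec : forall x y z, (x ≻ y) ≺ a2 z = a1 x ≻ (y ≺ z);
  bd_succ_succ : forall x y z, a1 x ≻ (y ≻ z) = (x ⋅ y) ≻ a2 z
}.

Record bihom_preLie : Prop := BihomPreLie {
  bl_maps : bihom_maps a1 a2;
  bl_ast : bihom_operation ast a1 a2;
  bl_preLie : forall x y z,
    (a2 x ∗ a1 y) ∗ a2 z - a1 (a2 x) ∗ (a1 y ∗ z) =
    (a2 y ∗ a1 x) ∗ a2 z - a1 (a2 y) ∗ (a1 x ∗ z)
}.

Record nc_bihom_prePoisson : Prop := NcBihomPrePoisson {
  bp_dendriform : bihom_dendriform;
  bp_preLie : bihom_preLie;
  bp_compat1 : forall x y z,
    (a2 x ∗ a1 y - a2 y ∗ a1 x) ≺ a2 z =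
    a1 (a2 x) ∗ (a1 y ≺ z) - a1 (a2 y) ≺ (a1 x ∗ z);
  bp_compat2 : forall x y z,
    a2 x ≻ (a1 (a2 y) ∗ a1 z - a2 z ∗ a1 (a1 y)) =
    a1 (a2 (a2 y)) ∗ (x ≻ a1 z) - (a2 (a2 y) ∗ x) ≻ a1 (a2 z);
  bp_compat3 : forall x y z,
    (a2 x ≺ a1 y + a2 x ≻ a1 y) ∗ a2 z =
    (a2 x ∗ a1 z) ≻ a2 y + a1 (a2 x) ≺ (a1 y ∗ z)
}.

End Algebras.

Section Bimodules.

Variables (K : fieldType) (A V : lmodType K).

(* The library puts no vector space structure on [{linear V -> V}] (that is,  *)
(* gl(V)) for arbitrary V; since addition and scaling in gl(V) are pointwise, *)
(* linearity of [f : A -> gl(V)] is linearity of every [x |-> f x v].         *)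
Definition linear_to_gl (f : A -> {linear V -> V}) : Prop :=
  forall v : V, linear (fun x => f x v).

Record bihom_action (f : A -> {linear V -> V})
    (a1 a2 : A -> A) (b1 b2 : V -> V) : Prop := BihomAction {
  ba_linear : linear_to_gl f;
  ba_equivariant1 : forall x v, b1 (f x v) = f (a1 x) (b1 v);
  ba_equivariant2 : forall x v, b2 (f x v) = f (a2 x) (b2 v)
}.

Definition add_action (f g : A -> {linear V -> V}) (x : A) (v : V) : V :=
  f x v + g x v.

Variables (prec succ ast : A -> A -> A) (a1 a2 : A -> A).
Variables (l_prec r_prec l_succ r_succ l_ast r_ast : A -> {linear V -> V}).
Variables (b1 b2 : V -> V).

Local Notation "x ≺ y" := (prec x y) (at level 40, left associativity).
Local Notation "x ≻ y" := (succ x y) (at level 40, left associativity).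
Local Notation "x ∗ y" := (ast x y) (at level 40, left associativity).
Local Notation "x ⋅ y" :=
  (add_op prec succ x y) (at level 40, left associativity).
Local Notation l_dot := (add_action l_prec l_succ).
Local Notation r_dot := (add_action r_prec r_succ).

Record dendriform_bimodule_laws : Prop := DendriformBimoduleLaws {
  db_l_prec_prec : forall x y v,
    l_prec (x ≺ y) (b2 v) = l_prec (a1 x) (l_dot y v);
  db_r_prec_l_prec : forall x y v,
    r_prec (a2 x) (l_prec y v) = l_prec (a1 y) (r_dot x v);
  db_r_prec_r_prec : forall x y v,
    r_prec (a2 y) (r_prec x v) = r_prec (x ⋅ y) (b1 v);
  db_l_prec_succ : forall x y v,
    l_prec (x ≻ y) (b2 v) = l_succ (a1 x) (l_prec y v);
  db_r_prec_l_succ : forall x y v,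
    r_prec (a2 x) (l_succ y v) = l_succ (a1 y) (r_prec x v);
  db_r_prec_r_succ : forall x y v,
    r_prec (a2 x) (r_succ y v) = r_succ (y ≺ x) (b1 v);
  db_l_succ_dot : forall x y v,
    l_succ (x ⋅ y) (b2 v) = l_succ (a1 x) (l_succ y v);
  db_r_succ_l_dot : forall x y v,
    r_succ (a2 x) (l_dot y v) = l_succ (a1 y) (r_succ x v);
  db_r_succ_r_dot : forall x y v,
    r_succ (a2 x) (r_dot y v) = r_succ (y ≻ x) (b1 v)
}.

Record preLie_bimodule_laws : Prop := PreLieBimoduleLaws {
  lb_l_ast : forall x y v,
    l_ast (a2 x ∗ a1 y - a2 y ∗ a1 x) (b2 v) =
    l_ast (a1 (a2 x)) (l_ast (a1 y) v) - l_ast (a1 (a2 y)) (l_ast (a1 x) v);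
  lb_r_ast : forall x y v,
    r_ast (a2 y) (l_ast (a2 x) (b1 v) - r_ast (a1 x) (b2 v)) =
    l_ast (a1 (a2 x)) (r_ast y (b1 v)) - r_ast (a1 x ∗ y) (b1 (b2 v))
}.

Record prePoisson_bimodule_compat : Prop := PrePoissonBimoduleCompat {
  bc1 : forall x y v,
    l_prec (a2 x ∗ a1 y - a2 y ∗ a1 x) (b2 v) =
    l_ast (a1 (a2 x)) (l_prec (a1 y) v) - l_prec (a1 (a2 y)) (l_ast (a1 x) v);
  bc2 : forall x y v,
    r_prec (a2 x) (l_ast (a2 y) (b1 v) - r_ast (a1 y) (b2 v)) =
    l_ast (a1 (a2 y)) (r_prec x (b1 v)) - r_prec (a1 y ∗ x) (b1 (b2 v));
  bc3 : forall x y v,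
    - r_prec (a2 x) (l_ast (a2 y) (b1 v) - r_ast (a1 y) (b2 v)) =
    r_ast (a1 y ≺ x) (b1 (b2 v)) - l_prec (a1 (a2 y)) (r_ast x (b1 v));
  bc4 : forall x y v,
    l_succ (a2 x) (l_ast (a1 (a2 y)) (b1 v) - r_ast (a1 (a1 y)) (b2 v)) =
    l_ast (a1 (a2 (a2 y))) (l_succ x (b1 v))
      - l_succ (a2 (a2 y) ∗ x) (b1 (b2 v));
  bc5 : forall x y v,
    r_succ (a1 (a2 x) ∗ a1 y - a2 y ∗ a1 (a1 x)) (b2 v) =
    l_ast (a1 (a2 (a2 x))) (r_succ (a1 y) v)
      - r_succ (a1 (a2 y)) (l_ast (a2 (a2 x)) v);
  bc6 : forall x y v,
    - l_succ (a2 x) (l_ast (a2 y) (b1 (b1 v)) - r_ast (a1 y) (b1 (b2 v))) =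
    r_ast (x ≻ a1 y) (b1 (b2 (b2 v)))
      - r_succ (a1 (a2 y)) (r_ast x (b2 (b2 v)));
  bc7 : forall x y v,
    l_ast (a2 x ⋅ a1 y) (b2 v) =
    r_succ (a2 y) (l_ast (a2 x) (b1 v)) + l_prec (a1 (a2 x)) (l_ast (a1 y) v);
  bc8 : forall x y v,
    r_ast (a2 x) (l_dot (a2 y) (b1 v)) =
    l_succ (a2 y ∗ a1 x) (b2 v) + l_prec (a1 (a2 y)) (r_ast x (b1 v));
  bc9 : forall x y v,
    r_ast (a2 x) (r_dot (a1 y) (b2 v)) =
    r_succ (a2 y) (r_ast (a1 x) (b2 v)) + r_prec (a1 y ∗ x) (b1 (b2 v))
}.

Record nc_bihom_prePoisson_bimodule : Prop := NcBihomPrePoissonBimodule {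
  bb_linear1 : linear b1;
  bb_linear2 : linear b2;
  bb_commute : forall v, b1 (b2 v) = b2 (b1 v);
  bb_l_prec : bihom_action l_prec a1 a2 b1 b2;
  bb_r_prec : bihom_action r_prec a1 a2 b1 b2;
  bb_l_succ : bihom_action l_succ a1 a2 b1 b2;
  bb_r_succ : bihom_action r_succ a1 a2 b1 b2;
  bb_l_ast : bihom_action l_ast a1 a2 b1 b2;
  bb_r_ast : bihom_action r_ast a1 a2 b1 b2;
  bb_dendriform : dendriform_bimodule_laws;
  bb_preLie : preLie_bimodule_laws;
  bb_compat : prePoisson_bimodule_compat
}.

(* The direct sum A ⊕ V is the product module [A * V]; x + u is (x, u). *)
Definition semidirect_op (op : A -> A -> A) (l r : A -> {linear V -> V})
    (p q : A * V) : A * V :=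
  (op p.1 q.1, l p.1 q.2 + r q.1 p.2).

Definition dsum_map (a : A -> A) (b : V -> V) (p : A * V) : A * V :=
  (a p.1, b p.2).

End Bimodules.

(* Main.v *)
(* Each identity on A ⊕ V is trilinear and V-valued terms only occur when      *)
(* exactly one of the three arguments lies in V: the A-component is the law of *)
(* A, and in the V-component the terms in each V-argument give one bimodule    *)
(* axiom.  (P2) involves the commutator of a1 y and z, up to a1 a2 = a2 a1.    *)
Require Import Defs.
From mathcomp Require Import all_boot all_order all_algebra.

Set Implicit Arguments.
Unset Strict Implicit.
Unset Printing Implicit Defensive.

Import GRing.Theory.
Local Open Scope ring_scope.

(** [A * V] carries the split null extension of A by V: a product of two elements of V is zero.
    Hence a three-variable identity amounts to the law of A together with one equation in V for each
    position of the V-argument. For the dendriform and compatibility laws these three equations are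
    bimodule axioms, up to sign; the pre-Lie law is symmetric in its first two variables, so two
    axioms suffice. [semidirect_commutator] and [semidirect_add_op] present commutators and sums of
    products with their V-component already sorted by V-argument. The axioms then rewrite it, and a
    permutation of terms finishes. *)

Lemma subrACA_swap (G : zmodType) (a b c d : G) :
  a + b - (c + d) = (a - d) - (c - b).
Proof. by rewrite opprB opprD [LHS](AC (2*2) ((1*4)*(2*3))). Qed.

(** Additivity on the left and moving two terms across the equation turn symmetry of the associator
    into an action law for the commutator. The bimodule axioms and (P1) have this second form. *)
Lemma preLie_commutatorE (K : fieldType) (U : lmodType K)
    (op : U -> U -> U) (a1 a2 : U -> U) (x y z : U) :
    bilinear_for *:%R *:%R op ->
  (op (op (a2 x) (a1 y)) (a2 z) - op (a1 (a2 x)) (op (a1 y) z) =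
   op (op (a2 y) (a1 x)) (a2 z) - op (a1 (a2 y)) (op (a1 x) z)) <->
  (op (op (a2 x) (a1 y) - op (a2 y) (a1 x)) (a2 z) =
   op (a1 (a2 x)) (op (a1 y) z) - op (a1 (a2 y)) (op (a1 x) z)).
Proof.
case=> opl _; have -> : forall u v w, op (u - v) w = op u w - op v w.
  move=> u v w; have /= := opl w (-1) v u.
  by rewrite !scaleN1r ![- _ + _]addrC.
by split=> /eqP h; apply/eqP; move: h;
  rewrite !subr_eq [X in _ -> _ == X](AC (2*1) (3*2*1)).
Qed.

Section Semidirect.

Variables (K : fieldType) (A V : lmodType K).
Implicit Types (op : A -> A -> A) (l r : A -> {linear V -> V}).
Implicit Types (a : A -> A) (b : V -> V) (p q : A * V).

Lemma dsum_map_linear a b :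
  linear a -> linear b -> linear (dsum_map a b : A * V -> A * V).
Proof. by move=> ha hb k [x u] [y v]; rewrite /dsum_map /= ha hb. Qed.

Lemma semidirect_maps a1 a2 b1 b2 :
    bihom_maps a1 a2 -> bihom_maps b1 b2 ->
  @bihom_maps K (A * V)%type (dsum_map a1 b1) (dsum_map a2 b2).
Proof.
case=> la1 la2 ca [lb1 lb2 cb]; split; try exact: dsum_map_linear.
by move=> [x u]; rewrite /dsum_map /= ca cb.
Qed.

Lemma semidirect_morph op l r a b :
    {morph a : x y / op x y} -> linear b ->
    (forall x v, b (l x v) = l (a x) (b v)) ->
    (forall x v, b (r x v) = r (a x) (b v)) ->
  {morph dsum_map a b : p q / semidirect_op op l r p q}.
Proof.
move=> ha hb hl hr [x u] [y v]; rewrite /dsum_map /semidirect_op /= ha -hl -hr.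
by have := hb 1 (l x v) (r y u); rewrite !scale1r => ->.
Qed.

Lemma semidirect_bilinear op l r :
    bilinear_for *:%R *:%R op -> linear_to_gl l -> linear_to_gl r ->
  @bilinear_for K (A * V)%type (A * V)%type (A * V)%type *:%R *:%R
    (semidirect_op op l r).
Proof.
case=> opl opr hl hr; split=> [[y v]|[x u]] k [x1 u1] [x2 u2].
  rewrite /semidirect_op /=; congr pair => /=; first exact: opl.
  by rewrite hl linearP scalerDr addrACA.
rewrite /semidirect_op /=; congr pair => /=; first exact: opr.
by rewrite hr linearP scalerDr addrACA.
Qed.

Lemma semidirect_operation op l r a1 a2 b1 b2 :
    bihom_operation op a1 a2 -> linear b1 -> linear b2 ->
    bihom_action l a1 a2 b1 b2 -> bihom_action r a1 a2 b1 b2 ->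
  @bihom_operation K (A * V)%type (semidirect_op op l r)
    (dsum_map a1 b1) (dsum_map a2 b2).
Proof.
case=> obil o1 o2 lb1 lb2 [ll l1 l2] [lr r1 r2].
by split; [exact: semidirect_bilinear|exact: semidirect_morph..].
Qed.

(** The sum of two semidirect products is again semidirect, for the summed actions. The pair is
    spelled out because [add_action] is a plain function, not a map into [{linear V -> V}]. *)
Lemma semidirect_add_op op op' l r l' r' p q :
  add_op (semidirect_op op l r) (semidirect_op op' l' r') p q =
  (add_op op op' p.1 q.1, add_action l l' p.1 q.2 + add_action r r' q.1 p.2).
Proof. by rewrite /add_op /semidirect_op; congr pair; exact: addrACA. Qed.

Variables (prec succ ast : A -> A -> A) (a1 a2 : A -> A).
Variables (l_prec r_prec l_succ r_succ l_ast r_ast : A -> {linear V -> V}).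
Variables (b1 b2 : V -> V).

Local Notation prec' := (semidirect_op prec l_prec r_prec).
Local Notation succ' := (semidirect_op succ l_succ r_succ).
Local Notation ast' := (semidirect_op ast l_ast r_ast).
Local Notation a1' := (dsum_map a1 b1).
Local Notation a2' := (dsum_map a2 b2).

Lemma semidirect_dendriform :
    bihom_dendriform prec succ a1 a2 -> bihom_maps b1 b2 ->
    bihom_action l_prec a1 a2 b1 b2 -> bihom_action r_prec a1 a2 b1 b2 ->
    bihom_action l_succ a1 a2 b1 b2 -> bihom_action r_succ a1 a2 b1 b2 ->
    dendriform_bimodule_laws prec succ a1 a2 l_prec r_prec l_succ r_succ b1 b2 ->
  @bihom_dendriform K (A * V)%type prec' succ' a1' a2'.
Proof.
case=> ha hp hs pp sp ss hb lp rp ls rs [d1 d2 d3 d4 d5 d6 d7 d8 d9].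
have [lb1 lb2 _] := hb.
split; first exact: semidirect_maps.
- exact: semidirect_operation.
- exact: semidirect_operation.
- move=> [x u] [y v] [z w]; rewrite semidirect_add_op.
  rewrite /semidirect_op /=; congr pair; first exact: pp.
  by rewrite !raddfD /= d1 d2 d3 /add_action !raddfD !addrA.
- move=> [x u] [y v] [z w]; rewrite /semidirect_op /=.
  congr pair; first exact: sp.
  by rewrite !raddfD /= d4 d5 d6 addrA.
- move=> [x u] [y v] [z w]; rewrite semidirect_add_op.
  rewrite /semidirect_op /=; congr pair; first exact: ss.
  (* Here the summed product stands on the right-hand side, so [d8] and [d9] are used backwards on
     the left. *)
  by rewrite [in LHS]raddfD d7 /= -d8 -d9 -addrA [in RHS]raddfD.
Qed.

(** Each bracketed difference collects the terms in one V-argument, in the exact shape to which the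
    axioms apply [r_ast], [r_prec] or [l_succ]. *)
Lemma semidirect_commutator p q :
  ast' (a2' p) (a1' q) - ast' (a2' q) (a1' p) =
  (ast (a2 p.1) (a1 q.1) - ast (a2 q.1) (a1 p.1),
   (l_ast (a2 p.1) (b1 q.2) - r_ast (a1 p.1) (b2 q.2)) -
   (l_ast (a2 q.1) (b1 p.2) - r_ast (a1 q.1) (b2 p.2))).
Proof. by congr pair; rewrite /= subrACA_swap. Qed.

Lemma semidirect_preLie :
    bihom_preLie ast a1 a2 -> bihom_maps b1 b2 ->
    bihom_action l_ast a1 a2 b1 b2 -> bihom_action r_ast a1 a2 b1 b2 ->
    preLie_bimodule_laws ast a1 a2 l_ast r_ast b1 b2 ->
  @bihom_preLie K (A * V)%type ast' a1' a2'.
Proof.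
case=> ha ho hpl hb la ra [e1 e2]; have [lb1 lb2 _] := hb.
have ho' : @bihom_operation K (A * V)%type ast' a1' a2'.
  exact: semidirect_operation.
split=> //; first exact: semidirect_maps.
move=> p q t; apply/(preLie_commutatorE _ _ _ _ _ (bo_bilinear ho')).
rewrite semidirect_commutator; congr pair => /=.
  exact/(preLie_commutatorE _ _ _ _ _ (bo_bilinear ho)).
(* [e1] treats V in the third place; [e2] serves both other places, which differ by exchanging the
   first two variables and a sign. *)
rewrite e1 raddfB /= e2 e2 !raddfD /= opprK.
(* The six terms, sorted by V-argument, are regrouped by the product on the right-hand side they
   come from. *)
by rewrite [LHS](AC (2*(2*2)) ((1*3*6)*(2*5*4))).
Qed.

End Semidirect.

Theorem proposition3p21 (K : fieldType) (hK : 2%N \notin [pchar K])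
    (A V : lmodType K)
    (prec succ ast : A -> A -> A) (a1 a2 : A -> A)
    (l_prec r_prec l_succ r_succ l_ast r_ast : A -> {linear V -> V})
    (b1 b2 : V -> V) :
  nc_bihom_prePoisson prec succ ast a1 a2 ->
  nc_bihom_prePoisson_bimodule prec succ ast a1 a2
    l_prec r_prec l_succ r_succ l_ast r_ast b1 b2 ->
  @nc_bihom_prePoisson K (A * V)%type
    (semidirect_op prec l_prec r_prec)
    (semidirect_op succ l_succ r_succ)
    (semidirect_op ast l_ast r_ast)
    (dsum_map a1 b1) (dsum_map a2 b2).
Proof.
case=> hd hl p1 p2 p3.
case=> lb1 lb2 cb lp rp ls rs la ra hbd hbl [c1 c2 c3 c4 c5 c6 c7 c8 c9].
have ca : forall x, a1 (a2 x) = a2 (a1 x) by case: hd => [[]].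
have hb : bihom_maps b1 b2 by [].
split; [exact: semidirect_dendriform|exact: semidirect_preLie|..].
- move=> p q t; rewrite semidirect_commutator; congr pair; first exact: p1.
  (* [c1], [c2], [c3] treat V in the third, second and first place; the first argument enters the
     commutator negatively, whence the sign in [c3]. *)
  rewrite /= c1 raddfB /= c2 -[X in _ - X]opprK c3 opprK !raddfD /=.
  by rewrite [LHS](AC (2*(2*2)) ((1*3*5)*(2*6*4))).
- move=> [x u] [y v] [z w].
  have -> : dsum_map a1 b1 (dsum_map a2 b2 (y, v)) =
      dsum_map a2 b2 (dsum_map a1 b1 (y, v)).
    by rewrite /dsum_map /= ca cb.
  rewrite [X in semidirect_op succ _ _ _ X]semidirect_commutator.
  congr pair; first by rewrite /= -ca; exact: p2.
  (* The structure maps return to the order used in the axioms; [c4], [c6], [c5] then treat V in the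
     third, second and first place. *)
  rewrite /= raddfB /= -[a2 (a1 y)]ca -[b2 (b1 v)]cb c4 -[X in _ - X]opprK c6.
  rewrite opprK c5 !raddfD /=.
  by rewrite [LHS](AC (2*2*2) ((1*5*3)*(2*(6*4)))).
- move=> [x u] [y v] [z w].
  have := semidirect_add_op prec succ l_prec r_prec l_succ r_succ.
  rewrite /add_op => ->; congr pair; first exact: p3.
  (* Again third, second and first place, in this order. *)
  rewrite /= [in LHS]raddfD c7 /= c8 c9 !raddfD /=.
  by rewrite [LHS](AC (2*(2*2)) ((3*(1*5))*(2*4*6))).
Qed.
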